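(* The logic $\mathbb{SKH}$ is decidable: there is an algorithm which, given any formula $\varphi$ of the language, decides whether $\varphi$ is derivable in the proof system $\mathbb{SKH}$.
   Context: **Language.** $\mathrm{PROP}=\{p_0,p_1,\dots\}$ is a countably infinite set of propositional symbols (with a fixed enumeration, so that formulas are finite objects that can be given to an algorithm). Formulas: $\phi ::= p\mid\neg\phi\mid(\phi\wedge\phi)\mid\mathcal{K}\phi\mid\mathcal{K}h\,\phi$ with $p\in\mathrm{PROP}$; $\bot,\vee,\to$ are the usual abbreviations. **System $\mathbb{SKH}$.** Axioms (with $p,q$ distinct propositional symbols): all axioms of propositional logic (all propositional tautologies); $\mathcal{K}p\wedge\mathcal{K}(p\to q)\to\mathcal{K}q$; $\mathcal{K}p\to p$; $\mathcal{K}p\to\mathcal{K}\mathcal{K}p$; $\neg\mathcal{K}p\to\mathcal{K}\neg\mathcal{K}p$; $\mathcal{K}p\to\mathcal{K}h\,p$; $\mathcal{K}h\,p\to\mathcal{K}h\,\mathcal{K}p$; $\mathcal{K}h\,p\to\mathcal{K}\mathcal{K}h\,p$; $\mathcal{K}h\,\mathcal{K}h\,p\to\mathcal{K}h\,p$; $\mathcal{K}h\,\bot\to\bot$. Rules: from $\varphi$ and $\varphi\to\psi$ infer $\psi$; from $\varphi$ infer $\mathcal{K}\varphi$; from $\varphi\to\psi$ infer $\mathcal{K}h\,\varphi\to\mathcal{K}h\,\psi$; from $\varphi(p)$ infer $\varphi[\psi/p]$ (uniform substitution of $\psi$ for $p$). **Semantics of the logic (for reference).** A model is $\mathcal{M}=\langle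 W,\mathrm{ACT},\sim,\{\xrightarrow{a}\mid a\in\mathrm{ACT}\},V\rangle$ where $W$ is a non-empty set, $\mathrm{ACT}$ is a set, $\sim$ is an equivalence relation on $W$, each $\xrightarrow{a}$ is a binary relation on $W$, and $V:W\to 2^{\mathrm{PROP}}$. $[s]$ is the $\sim$-class of $s$, $[W]$ the set of all $\sim$-classes; $a$ is executable at $s$ if $s\xrightarrow{a}t$ for some $t$; $[s]\xrightarrow{a}[t]$ means $s'\xrightarrow{a}t'$ for some $s'\in[s]$, $t'\in[t]$. A strategy is a partial function $\sigma:[W]\to\mathrm{ACT}$ such that for every $[s]\in\mathrm{dom}(\sigma)$, $\sigma([s])$ is executable at every $s'\in[s]$ (the empty function is allowed). A possible execution of $\sigma$ is a non-empty, finite or infinite, sequence $[s_0][s_1]\cdots$ of classes such that whenever $[s_{i+1}]$ occurs, $[s_i]\in\mathrm{dom}(\sigma)$ and $[s_i]\xrightarrow{\sigma([s_i])}[s_{i+1}]$; it is complete if it is infinite or its last class (leaf-node) is not in $\mathrm{dom}(\sigma)$. $\mathrm{CELeaf}(\sigma,s)$ is the set of leaf-nodes of finite complete executions of $\sigma$ starting from $[s]$. $\mathcal{M},s\vDash p$ iff $p\in V(s)$; Boolean cases as usual; $\mathcal{M},s\vDash\mathcal{K}\phi$ iff $\mathcal{M},s'\vDash\phi$ for all $s'\sim s$; $\mathcal{M},s\vDash\mathcal{K}h\,\phi$ iff there is a strategy $\sigma$ such that (1) every $[t]\in\mathrm{CELeaf}(\sigma,s)$ satisfies $\mathcal{M},u\vDash\phi$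 for all $u\in[t]$, and (2) all complete executions of $\sigma$ starting from $[s]$ are finite. *)

(* Defs.v *)
From mathcomp Require Import all_boot zify.

Set Implicit Arguments.
Unset Strict Implicit.
Unset Printing Implicit Defensive.

Inductive formula : Type :=
| Var (p : nat)
| Neg (A : formula)
| And (A B : formula)
| K (A : formula)
| Kh (A : formula).

Definition Imp (A B : formula) : formula := Neg (And A (Neg B)).
Definition Bot : formula := And (Var 0) (Neg (Var 0)).

(* Uniform substitution A[B/p]. *)
Fixpoint subst (p : nat) (B A : formula) : formula :=
  match A with
  | Var q => if q == p then B else Var q
  | Neg A1 => Neg (subst p B A1)
  | And A1 A2 => And (subst p B A1) (subst p B A2)
  | K A1 => K (subst p B A1)
  | Kh A1 => Kh (subst p B A1)
  end.

(* Truth-table value: formulas [Var p], [K A] and [Kh A] are the atoms of the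
   valuation [v], whose values on other formulas are irrelevant. *)
Fixpoint bool_eval (v : formula -> bool) (A : formula) : bool :=
  match A with
  | Neg A1 => ~~ bool_eval v A1
  | And A1 A2 => bool_eval v A1 && bool_eval v A2
  | _ => v A
  end.

Definition tautology (A : formula) : Prop := forall v, bool_eval v A.

Inductive SKH : formula -> Prop :=
| ax_taut A : tautology A -> SKH A
| ax_distK p q : p <> q ->
    SKH (Imp (And (K (Var p)) (K (Imp (Var p) (Var q)))) (K (Var q)))
| ax_T p : SKH (Imp (K (Var p)) (Var p))
| ax_4 p : SKH (Imp (K (Var p)) (K (K (Var p))))
| ax_5 p : SKH (Imp (Neg (K (Var p))) (K (Neg (K (Var p)))))
| ax_KtoKh p : SKH (Imp (K (Var p)) (Kh (Var p)))
| ax_KhtoKhK p : SKH (Imp (Kh (Var p)) (Kh (K (Var p))))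
| ax_KhtoKKh p : SKH (Imp (Kh (Var p)) (K (Kh (Var p))))
| ax_KhKh p : SKH (Imp (Kh (Kh (Var p))) (Kh (Var p)))
| ax_Khbot : SKH (Imp (Kh Bot) Bot)
| rule_MP A B : SKH A -> SKH (Imp A B) -> SKH B
| rule_NecK A : SKH A -> SKH (K A)
| rule_MonoKh A B : SKH (Imp A B) -> SKH (Imp (Kh A) (Kh B))
| rule_Sub p A B : SKH A -> SKH (subst p B A).

(* Algorithms are Kleene's mu-recursive functions, given by their defining
   terms; [recf n] is the type of terms for n-ary partial functions. An
   existential over Rocq functions [formula -> bool] would not express
   decidability in the presence of classical axioms. *)
Inductive recf : nat -> Type :=
| rf_zero : recf 0
| rf_succ : recf 1
| rf_proj n (i : 'I_n) : recf n
| rf_comp m n (f : recf m) (g : 'I_m -> recf n) : recf n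
| rf_prec n (f : recf n) (g : recf n.+2) : recf n.+1
| rf_mu n (f : recf n.+1) : recf n.

(* [computes f v r]: the partial function [f] is defined at [v], with value
   [r]. In the primitive recursion clause the recursion variable is the first
   argument, and [s k] is the value at [k]: h(0, v) = f(v) and
   h(k+1, v) = g(k, h(k, v), v). In the minimisation clause [f] must be
   defined, and nonzero, at all arguments below the least zero. *)
Fixpoint computes n (f : recf n) : n.-tuple nat -> nat -> Prop :=
  match f in recf n return n.-tuple nat -> nat -> Prop with
  | rf_zero => fun _ r => r = 0
  | rf_succ => fun v r => r = (thead v).+1
  | rf_proj _ i => fun v r => r = tnth v i
  | rf_comp m _ f g => fun v r =>
      exists w : m.-tuple nat,
        (forall i, computes (g i) v (tnth w i)) /\ computes f w r
  | rf_prec n f g => fun v r =>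
      exists s : nat -> nat,
        [/\ computes f [tuple of behead v] (s 0),
            forall k, k < thead v ->
              computes g [tuple of k :: s k :: behead v] (s k.+1)
          & r = s (thead v)]
  | rf_mu _ f => fun v r =>
      computes f [tuple of r :: v] 0 /\
      forall k, k < r -> exists y, computes f [tuple of k :: v] y.+1
  end.

Lemma computes_fun n (f : recf n) v r1 r2 :
  computes f v r1 -> computes f v r2 -> r1 = r2.
Proof.
elim: f v r1 r2 => {n}
  [|v|n i v|m n f IHf g IHg v|n f IHf g IHg v|n f IHf v] r1 r2 /=.
- by move=> ? -> ->.
- by move=> -> ->.
- by move=> -> ->.
- move=> [w1 [Hg1 Hf1]] [w2 [Hg2 Hf2]].
  have E : w1 = w2 by apply: eq_from_tnth => i; apply: IHg (Hg1 i) (Hg2 i).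
  by apply: IHf Hf1 _; rewrite E.
- move=> [s [Hs0 HsS ->]] [t [Ht0 HtS ->]].
  suff E k : k <= thead v -> s k = t k by apply: E.
  elim: k => [_|k IHk lt_k]; first exact: IHf Hs0 Ht0.
  have := HsS k lt_k; rewrite (IHk (ltnW lt_k)) => H.
  exact: IHg H (HtS k lt_k).
- move=> [H1 L1] [H2 L2]; case: (ltngtP r1 r2) => // lt_r.
    by have [y Hy] := L2 _ lt_r; have := IHf _ _ _ H1 Hy.
  by have [y Hy] := L1 _ lt_r; have := IHf _ _ _ H2 Hy.
Qed.

(* Cantor's pairing function. *)
Definition cpair (x y : nat) : nat := 'C((x + y).+1, 2) + y.

Lemma cpair_inj x1 y1 x2 y2 :
  cpair x1 y1 = cpair x2 y2 -> x1 = x2 /\ y1 = y2.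
Proof.
have lt_cpair a b c d : a + b < c + d -> cpair a b < cpair c d.
  move=> lt_s; rewrite /cpair; apply: leq_trans (leq_addr _ _).
  apply: (@leq_trans 'C((a + b).+2, 2)); last exact: leq_bin2l.
  by rewrite (binS _.+1) bin1; lia.
move=> E; case: (ltngtP (x1 + y1) (x2 + y2)) => [/lt_cpair|/lt_cpair|Es].
- by rewrite E ltnn.
- by rewrite E ltnn.
- by move: E; rewrite /cpair Es; lia.
Qed.

(* A Goedel numbering, through which the algorithm receives formulas. *)
Fixpoint code (A : formula) : nat :=
  match A with
  | Var p => 5 * p
  | Neg A1 => 5 * code A1 + 1
  | And A1 A2 => 5 * cpair (code A1) (code A2) + 2
  | K A1 => 5 * code A1 + 3
  | Kh A1 => 5 * code A1 + 4
  end.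

Lemma code_inj : injective code.
Proof.
elim=> [p|A IH|A IHA B IHB|A IH|A IH] [q|C|C D|C|C] /= E; try lia.
- by congr Var; lia.
- by congr Neg; apply: IH; lia.
- have /cpair_inj[EA EB] : cpair (code A) (code B) = cpair (code C) (code D).
    by lia.
  by rewrite (IHA _ EA) (IHB _ EB).
- by congr K; apply: IH; lia.
- by congr Kh; apply: IH; lia.
Qed.

(* One algorithm halts on every formula, answering 1 for yes and 0 for no. *)
Definition decided_by_algorithm (P : formula -> Prop) : Prop :=
  exists f : recf 1, forall A : formula,
    (P A -> computes f [tuple code A] 1) /\
    (~ P A -> computes f [tuple code A] 0).

(* Main.v *)
(* [Kh] behaves as a monotone closure operator on sets of [K]-classes that fixes
   the empty set, so SKH can be refuted in finite models made of types. Since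
   [code] is a bijection onto [nat], the formulas with code below [M] form a
   finite set closed under subformulas (and containing [K A] along with [Kh A],
   whose code is larger by one). A type is the binary number [t < 2 ^ M] whose
   bit [i] is the truth value of the formula with code [i], and a model is the
   binary number [s < 2 ^ (2 ^ M)] whose bits select a set of types. The model is
   coherent when in each of its types every bit agrees with the semantic clause
   of the corresponding formula. Then [A] is underivable iff some coherent model
   contains a type refuting [A], where [M] is [(code A).+1]: coherent models are
   sound, and the set of all SKH-consistent types is coherent. This criterion
   only involves bounded quantifiers, hence is recursive. *)

From Stdlib Require Import Classical.
From mathcomp Require Import all_boot zify.
Require Import Defs.

Set Implicit Arguments.
Unset Strict Implicit.
Unset Printing Implicit Defensive.

(** * Binary digits *)

Definition bit (t i : nat) : bool := odd (iter i half t).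

(** Classical logic settles each digit, so [P] may be undecidable. This turns sign sequences into
    types and the set of consistent types into a model; neither number has to be computed. *)
Lemma exists_bits (P : nat -> Prop) n :
  exists2 t, t < 2 ^ n & forall i, i < n -> (bit t i <-> P i).
Proof.
elim: n P => [|n IHn] P; first by exists 0.
have [t lt_t Pt] := IHn (fun i => P i.+1).
have [b Pb] : exists b : bool, b <-> P 0.
  by have [P0|nP0] := classic (P 0); [exists true | exists false].
exists (b + t.*2) => [|[_|i lt_i]]; first by rewrite expnS; case: b {Pb}; lia.
  by rewrite /bit /= oddD odd_double addbF oddb.
by rewrite /bit iterSr half_bit_double; apply: Pt.
Qed.

(** * Computable functions *)

(* [F] reads the [n] arguments from the environment [e 0, ..., e n.-1]. *)
Definition computable n (F : (nat -> nat) -> nat) : Prop :=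
  exists f : recf n, forall v : n.-tuple nat, computes f v (F (nth 0 v)).

Definition computableb n (P : (nat -> nat) -> bool) : Prop :=
  computable n (fun e => P e).

Lemma computable_eq n F G :
    (forall v : n.-tuple nat, F (nth 0 v) = G (nth 0 v)) ->
  computable n F -> computable n G.
Proof. by move=> eqFG [f Hf]; exists f => v; rewrite -eqFG. Qed.

Lemma computable_var n i : i < n -> computable n (fun e => e i).
Proof.
by move=> lt_i; exists (rf_proj (Ordinal lt_i)) => v; rewrite /= (tnth_nth 0).
Qed.

Lemma computable_comp m n F (G : nat -> (nat -> nat) -> nat) :
    computable m F -> (forall i, i < m -> computable n (G i)) ->
  computable n (fun e => F (nth 0 (mkseq (G^~ e) m))).
Proof.
move=> [f Hf] HG.
have [g Hg] : exists g : 'I_m -> recf n,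
    forall i v, computes (g i) v (G i (nth 0 v)).
  apply: (fin_all_exists (U := fun=> recf n)
    (P := fun (i : 'I_m) f => forall v, computes f v (G i (nth 0 v)))) => i.
  exact: HG.
exists (rf_comp f g) => v.
pose w := [tuple of mkseq (G^~ (nth 0 v)) m].
exists w; split=> [i|]; last exact: Hf.
by rewrite (tnth_nth 0) nth_mkseq.
Qed.

Lemma computable_prec n F (G : nat -> nat -> (nat -> nat) -> nat) :
    computable n F ->
    computable n.+2 (fun e => G (e 0) (e 1) (fun i => e i.+2)) ->
  computable n.+1 (fun e =>
    nat_rect _ (F (fun i => e i.+1)) (fun k r => G k r (fun i => e i.+1))
      (e 0)).
Proof.
move=> [f Hf] [g Hg]; exists (rf_prec f g) => v.
have nth_behead : nth 0 (behead v) = fun i => nth 0 v i.+1.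
  by case/tupleP: v => x v.
(* The sequence of intermediate values demanded by [computes] is the recursor itself. *)
exists (nat_rect _ (F (fun i => nth 0 v i.+1))
         (fun k r => G k r (fun i => nth 0 v i.+1))).
split=> [|k _|]; last by rewrite /thead (tnth_nth 0).
  by rewrite -nth_behead; apply: Hf.
by rewrite -nth_behead; apply: Hg.
Qed.

Lemma mkseq_cons (T : Type) (f : nat -> T) n :
  mkseq f n.+1 = f 0 :: mkseq (fun i => f i.+1) n.
Proof. by rewrite /mkseq /= (iotaDl 1) -map_comp. Qed.

Lemma mkseq_nth_tuple n (v : n.-tuple nat) : mkseq (nth 0 v) n = v.
Proof. by rewrite -[RHS](mkseq_nth 0) size_tuple. Qed.

(** Here the recursion runs up to a computed bound: [computable_prec] is composed with [B] in front
    of the unchanged arguments. *)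
Lemma computable_natrec n B F (G : nat -> nat -> (nat -> nat) -> nat) :
    computable n B -> computable n F ->
    computable n.+2 (fun e => G (e 0) (e 1) (fun i => e i.+2)) ->
  computable n (fun e => nat_rect _ (F e) (fun k r => G k r e) (B e)).
Proof.
move=> HB /computable_prec HF /HF{}HF.
apply: computable_eq (computable_comp
  (G := fun i => if i is j.+1 then fun e => e j else B) HF _) => [v|[|i]] //.
  by rewrite mkseq_cons mkseq_nth_tuple.
by move=> lt_i; exact: (@computable_var n i lt_i).
Qed.

Lemma computable_comp1 n (h : nat -> nat) F :
    computable 1 (fun e => h (e 0)) -> computable n F ->
  computable n (fun e => h (F e)).
Proof.
move=> Hh HF.
by apply: computable_eq (computable_comp (G := fun=> F) Hh (fun i _ => HF)).
Qed.

Lemma computable_comp2 n (h : nat -> nat -> nat) F G :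
    computable 2 (fun e => h (e 0) (e 1)) -> computable n F ->
  computable n G -> computable n (fun e => h (F e) (G e)).
Proof.
move=> Hh HF HG.
apply: computable_eq (computable_comp
  (G := fun i => if i is 0 then F else G) Hh _) => [//|[|i] _ //].
Qed.

Lemma computable_succ n F : computable n F -> computable n (fun e => (F e).+1).
Proof.
apply: (computable_comp1 (h := S)); exists rf_succ => v.
by rewrite /= /thead (tnth_nth 0).
Qed.

Lemma computable_const n c : computable n (fun=> c).
Proof.
elim: c => [|c]; last exact: computable_succ.
(* The zero function is nullary; composing it with an empty family of arguments raises its arity to
   [n]. *)
have H0 : computable 0 (fun=> 0) by exists rf_zero.
by apply: computable_eq (computable_comp (G := fun=> fun=> 0) H0 _).
Qed.

Lemma computable_pred n F : computable n F -> computable n (fun e => (F e).-1).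
Proof.
apply: computable_comp1.
apply: computable_eq (computable_natrec (G := fun k _ _ => k)
  (computable_var (isT : 0 < 1)) (computable_const 1 0)
  (computable_var (isT : 0 < 3))) => v.
by case: (nth 0 v 0).
Qed.

Lemma computable_add n F G :
  computable n F -> computable n G -> computable n (fun e => F e + G e).
Proof.
apply: computable_comp2.
apply: computable_eq (computable_natrec (G := fun _ r _ => r.+1)
  (computable_var (isT : 1 < 2)) (computable_var (isT : 0 < 2))
  (computable_succ (computable_var (isT : 1 < 4)))) => v.
by elim: (nth 0 v 1) => [|k IHk]; rewrite ?addn0 // addnS -IHk.
Qed.

Lemma computable_sub n F G :
  computable n F -> computable n G -> computable n (fun e => F e - G e).
Proof.
apply: computable_comp2.
apply: computable_eq (computable_natrec (G := fun _ r _ => r.-1)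
  (computable_var (isT : 1 < 2)) (computable_var (isT : 0 < 2))
  (computable_pred (computable_var (isT : 1 < 4)))) => v.
by elim: (nth 0 v 1) => [|k IHk]; rewrite ?subn0 // subnS -IHk.
Qed.

Lemma computable_mul n F G :
  computable n F -> computable n G -> computable n (fun e => F e * G e).
Proof.
apply: computable_comp2.
apply: computable_eq (computable_natrec (G := fun _ r e => r + e 0)
  (computable_var (isT : 1 < 2)) (computable_const 2 0)
  (computable_add (computable_var (isT : 1 < 4))
    (computable_var (isT : 2 < 4)))) => v.
by elim: (nth 0 v 1) => [|k IHk]; rewrite ?muln0 // mulnSr -IHk.
Qed.

Lemma computable_exp2 n F : computable n F -> computable n (fun e => 2 ^ F e).
Proof.
apply: computable_comp1.
apply: computable_eq (computable_natrec (G := fun _ r _ => 2 * r)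
  (computable_var (isT : 0 < 1)) (computable_const 1 1)
  (computable_mul (computable_const 3 2) (computable_var (isT : 1 < 3)))) => v.
by elim: (nth 0 v 0) => [|k IHk]; rewrite ?expnS -?IHk.
Qed.

Lemma computable_neg n P :
  computableb n P -> computableb n (fun e => ~~ P e).
Proof.
move=> HP; apply: computable_eq (computable_sub (computable_const n 1) HP) => v.
by case: (P _).
Qed.

Lemma computable_and n P Q :
  computableb n P -> computableb n Q -> computableb n (fun e => P e && Q e).
Proof.
move=> HP HQ; apply: computable_eq (computable_mul HP HQ) => v.
by rewrite mulnb.
Qed.

Lemma computable_imp n P Q :
  computableb n P -> computableb n Q -> computableb n (fun e => P e ==> Q e).
Proof.
move=> HP HQ; apply: computable_eq
  (computable_neg (computable_and HP (computable_neg HQ))) => v.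
by case: (P _) (Q _) => [] [].
Qed.

Lemma computable_eqb n P Q :
  computableb n P -> computableb n Q -> computableb n (fun e => P e == Q e).
Proof.
move=> HP HQ; apply: computable_eq
  (computable_and (computable_imp HP HQ) (computable_imp HQ HP)) => v.
by case: (P _) (Q _) => [] [].
Qed.

Lemma computable_lt n F G :
  computable n F -> computable n G -> computableb n (fun e => F e < G e).
Proof.
(* By truncated subtraction, [1 - ((F e).+1 - G e)] is 1 when [F e < G e] and 0 otherwise. *)
move=> HF HG; apply: computable_eq (computable_sub (computable_const n 1)
  (computable_sub (computable_succ HF) HG)) => v.
by rewrite -subn_eq0; case: ((F _).+1 - G _).
Qed.

Lemma computable_odd n F : computable n F -> computableb n (fun e => odd (F e)).
Proof.
apply: (computable_comp1 (h := fun x => odd x)).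
apply: computable_eq (computable_natrec (G := fun _ r _ => 1 - r)
  (computable_var (isT : 0 < 1)) (computable_const 1 0)
  (computable_sub (computable_const 3 1) (computable_var (isT : 1 < 3)))) => v.
by elim: (nth 0 v 0) => //= k ->; case: (odd k).
Qed.

Lemma computable_half n F : computable n F -> computable n (fun e => (F e)./2).
Proof.
apply: computable_comp1.
(* Halving grows by one exactly when passing from an odd [k] to [k.+1]. *)
apply: computable_eq (computable_natrec (G := fun k r _ => odd k + r)
  (computable_var (isT : 0 < 1)) (computable_const 1 0)
  (computable_add (computable_odd (computable_var (isT : 0 < 3)))
    (computable_var (isT : 1 < 3)))) => v.
by elim: (nth 0 v 0) => //= k ->; rewrite uphalf_half.
Qed.

Lemma computable_bit n F G :
  computable n F -> computable n G -> computableb n (fun e => bit (F e) (G e)).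
Proof.
apply: (computable_comp2 (h := fun x y => bit x y)).
apply: (computable_odd (F := fun e => iter (e 1) half (e 0))).
apply: computable_eq (computable_natrec (G := fun _ r _ => r./2)
  (computable_var (isT : 1 < 2)) (computable_var (isT : 0 < 2))
  (computable_half (computable_var (isT : 1 < 4)))) => v.
by elim: (nth 0 v 1) => //= k ->.
Qed.

Lemma computable_cpair n F G :
  computable n F -> computable n G -> computable n (fun e => cpair (F e) (G e)).
Proof.
move=> HF HG; have HFG := computable_add HF HG.
apply: computable_eq (computable_add
  (computable_half (computable_mul (computable_succ HFG) HFG)) HG) => v.
by rewrite /cpair bin2.
Qed.

Lemma computable_all n B P :
    computable n B -> computableb n.+1 (fun e => P (e 0) (fun i => e i.+1)) ->
  computableb n (fun e => all (fun x => P x e) (iota 0 (B e))).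
Proof.
move=> HB HP.
(* The recursion step carries the accumulated product as argument 1, which [P] must skip. *)
have HP2 : computableb n.+2 (fun e => P (e 0) (fun i => e i.+2)).
  apply: computable_eq (computable_comp
    (G := fun i e => if i is j.+1 then e j.+2 else e 0) HP _) => [v|i lt_i].
    rewrite mkseq_cons; case/tupleP: v => x v; case/tupleP: v => y v /=.
    by rewrite mkseq_nth_tuple.
  by case: i lt_i => [|i] lt_i; apply: computable_var.
apply: computable_eq (computable_natrec (G := fun k r e => P k e * r)
  HB (computable_const n 1)
  (computable_mul HP2 (computable_var (isT : 1 < n.+2)))) => v.
elim: (B _) => [//|k IHk]; rewrite [LHS]/= IHk.
by rewrite -[in RHS]addn1 iotaD all_cat /= andbT mulnb andbC.
Qed.

Lemma computable_has n B P :
    computable n B -> computableb n.+1 (fun e => P (e 0) (fun i => e i.+1)) ->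
  computableb n (fun e => has (fun x => P x e) (iota 0 (B e))).
Proof.
move=> HB HP; apply: computable_eq (computable_neg
  (computable_all (P := fun x e => ~~ P x e) HB (computable_neg HP))) => v.
by rewrite -has_predC; congr (nat_of_bool _); apply: eq_has => x; apply: negbK.
Qed.

Definition members (s M : nat) : seq nat :=
  [seq t <- iota 0 (2 ^ M) | bit s t].

Lemma mem_members s M t : (t \in members s M) = (t < 2 ^ M) && bit s t.
Proof. by rewrite mem_filter mem_iota andbC. Qed.

Lemma computable_all_members n A B P :
    computable n A -> computable n B ->
    computableb n.+1 (fun e => bit (A (fun i => e i.+1)) (e 0)) ->
    computableb n.+1 (fun e => P (e 0) (fun i => e i.+1)) ->
  computableb n (fun e => all (fun x => P x e) (members (A e) (B e))).
Proof.
move=> HA HB HAP HP; apply: computable_eq (computable_all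
  (P := fun x e => bit (A e) x ==> P x e)
  (computable_exp2 HB) (computable_imp HAP HP)) => v.
by rewrite /members all_filter.
Qed.

Lemma computable_has_members n A B P :
    computable n A -> computable n B ->
    computableb n.+1 (fun e => bit (A (fun i => e i.+1)) (e 0)) ->
    computableb n.+1 (fun e => P (e 0) (fun i => e i.+1)) ->
  computableb n (fun e => has (fun x => P x e) (members (A e) (B e))).
Proof.
move=> HA HB HAP HP; apply: computable_eq (computable_neg
  (computable_all_members (P := fun x e => ~~ P x e) HA HB HAP
    (computable_neg HP))) => v.
by rewrite -has_predC; congr (nat_of_bool _); apply: eq_has => x; apply: negbK.
Qed.

(** * Finite models *)

(** The [Kh]-bits are compared along with the [K]-bits so that extensions of [Kh]-formulas are
    unions of classes, as [Kh p -> K (Kh p)] demands. *)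
Definition sim (M t u : nat) : bool :=
  all (fun c => ((5 * c + 3 < M) ==> (bit t (5 * c + 3) == bit u (5 * c + 3)))
             && ((5 * c + 4 < M) ==> (bit t (5 * c + 4) == bit u (5 * c + 4))))
    (iota 0 M).

(* The least set that contains [X] and is an intersection of extensions
   [bit _ (5 * e + 4)] of formulas [Kh], or empty when [X] is empty. *)
Definition cl (M : nat) (S : seq nat) (X : pred nat) (t : nat) : bool :=
  has X S &&
  all (fun e => (5 * e + 4 < M) ==>
         all (fun u => X u ==> bit u (5 * e + 4)) S ==> bit t (5 * e + 4))
    (iota 0 M).

(* The indices [5 * c + 1], [5 * cpair c d + 2], [5 * c + 3] and [5 * c + 4] are
   the codes of negations, conjunctions, [K]- and [Kh]-formulas. As [5 * c + 3]
   codes a [K]-formula, its extension is a union of [sim]-classes. *)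
Definition coherent_at (M : nat) (S : seq nat) (t : nat) : bool :=
  all (fun c =>
    [&& (5 * c + 1 < M) ==> (bit t (5 * c + 1) == ~~ bit t c),
        all (fun d => (5 * cpair c d + 2 < M) ==>
               (bit t (5 * cpair c d + 2) == bit t c && bit t d)) (iota 0 M),
        (5 * c + 3 < M) ==>
          (bit t (5 * c + 3) == all (fun u => sim M t u ==> bit u c) S)
      & (5 * c + 4 < M) ==>
          (bit t (5 * c + 4) == cl M S (fun u => bit u (5 * c + 3)) t)])
    (iota 0 M).

Definition coherent (M : nat) (S : seq nat) : bool := all (coherent_at M S) S.

Definition refutable (n : nat) : bool :=
  has (fun s => coherent n.+1 (members s n.+1)
             && has (fun t => ~~ bit t n) (members s n.+1))
    (iota 0 (2 ^ (2 ^ n.+1))).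

Lemma computable_refutable : computableb 1 (fun e => refutable (e 0)).
Proof.
rewrite /refutable /coherent /coherent_at /cl /sim.
(* Once unfolded, the criterion consists of bounded quantifiers, connectives, digits and arithmetic,
   each with its own closure lemma. *)
by repeat first
  [ apply computable_var | apply computable_const
  | apply computable_all_members | apply computable_has_members
  | apply computable_all | apply computable_has
  | apply computable_neg | apply computable_and | apply computable_imp
  | apply computable_eqb | apply computable_lt | apply computable_bit
  | apply computable_cpair | apply computable_exp2 | apply computable_mul
  | apply computable_add | apply computable_succ ].
Qed.

(** * Similarity and the closure operator *)

Lemma sim_refl M t : sim M t t.
Proof. by apply/allP => c _; rewrite !eqxx !implybT. Qed.

Lemma sim_sym M t u : sim M t u = sim M u t.
Proof. by apply: eq_all => c; congr (_ && _); rewrite eq_sym. Qed.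

Lemma simP M t u :
  reflect (forall c, (5 * c + 3 < M -> bit t (5 * c + 3) = bit u (5 * c + 3)) /\
                     (5 * c + 4 < M -> bit t (5 * c + 4) = bit u (5 * c + 4)))
          (sim M t u).
Proof.
apply: (iffP allP) => [H c | H c _]; last first.
  by have [H3 H4] := H c; apply/andP; split; apply/implyP => lt_c; apply/eqP; auto.
split=> lt_c; have /H/andP[/implyP H3 /implyP H4] : c \in iota 0 M
  by rewrite mem_iota; lia.
- exact/eqP/H3.
- exact/eqP/H4.
Qed.

Lemma sim_trans M : transitive (sim M).
Proof.
move=> u t w /simP tu /simP uw; apply/simP => c.
have [tu3 tu4] := tu c; have [uw3 uw4] := uw c.
by split=> lt_c; [rewrite tu3 ?uw3 | rewrite tu4 ?uw4].
Qed.

Lemma simT M t u : sim M t u -> sim M t =1 sim M u.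
Proof.
move=> tu w; apply/idP/idP; last exact: sim_trans.
by apply: sim_trans; rewrite sim_sym.
Qed.

Lemma clP M S (X : pred nat) t :
  reflect ((exists2 u, u \in S & X u) /\
           forall e, 5 * e + 4 < M ->
             (forall u, u \in S -> X u -> bit u (5 * e + 4)) -> bit t (5 * e + 4))
          (cl M S X t).
Proof.
apply: (iffP andP) => [[/hasP HX /allP H] | [/hasP HX H]]; split=> //.
  move=> e lt_e HY; have /H/implyP/(_ lt_e)/implyP : e \in iota 0 M
    by rewrite mem_iota; lia.
  by apply; apply/allP => u Su; apply/implyP; apply: HY.
apply/allP => e _; apply/implyP => lt_e; apply/implyP => /allP HY.
by apply: H => // u Su Xu; have /implyP := HY u Su; apply.
Qed.

(** The closure laws mirror the proof system: monotonicity gives the rule for [Kh], [sub_cl] gives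
    [ax_KtoKh], [cl_idem] gives [ax_KhKh], and [sim_cl] gives [ax_KhtoKKh]. *)
Lemma cl_mono M S (X Y : pred nat) t :
  (forall u, u \in S -> X u -> Y u) -> cl M S X t -> cl M S Y t.
Proof.
move=> sXY /clP[[u Su Xu] H]; apply/clP; split; first by exists u; auto.
by move=> e lt_e HY; apply: H => // w Sw Xw; apply: HY => //; apply: sXY.
Qed.

Lemma eq_cl M S (X Y : pred nat) t : X =1 Y -> cl M S X t = cl M S Y t.
Proof. by move=> eqXY; apply/idP/idP; apply: cl_mono => u _; rewrite eqXY. Qed.

Lemma sub_cl M S (X : pred nat) t : t \in S -> X t -> cl M S X t.
Proof. by move=> St Xt; apply/clP; split; [exists t | move=> e _; apply]. Qed.

(** Any [Kh]-extension that contains [X] already contains [cl M S X]. *)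
Lemma cl_idem M S (X : pred nat) t : cl M S (cl M S X) t -> cl M S X t.
Proof.
case/clP=> -[u _ /clP[HX _]] H; apply/clP; split=> // e lt_e HY.
by apply: H => // w _ /clP[_]; apply.
Qed.

Lemma sim_cl M S (X : pred nat) t u : sim M t u -> cl M S X t -> cl M S X u.
Proof.
move=> /simP tu /clP[HX H]; apply/clP; split=> // e lt_e HY.
by have [_ <- //] := tu e; apply: H.
Qed.

(** The valuation is a parameter because uniform substitution changes it, while [cl] always refers
    to the digits of the types. The [Kh] clause repeats the body of the [K] clause to keep the
    recursion structural. *)
Fixpoint sat (M : nat) (S : seq nat) (V : nat -> pred nat) (A : formula)
    : pred nat :=
  match A with
  | Var p => V p
  | Neg A1 => fun t => ~~ sat M S V A1 t
  | And A1 A2 => fun t => sat M S V A1 t && sat M S V A2 t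
  | K A1 => fun t => all (fun u => sim M t u ==> sat M S V A1 u) S
  | Kh A1 =>
      cl M S (fun t => all (fun u => sim M t u ==> sat M S V A1 u) S)
  end.

Lemma sat_K M S V A t :
  reflect (forall u, u \in S -> sim M t u -> sat M S V A u) (sat M S V (K A) t).
Proof.
by apply: (iffP allP) => H u Su; [move/implyP: (H u Su) | apply/implyP; apply: H].
Qed.

Lemma sat_Kh M S V A : sat M S V (Kh A) = cl M S (sat M S V (K A)).
Proof. by []. Qed.

Lemma sat_Kh_mono M S V A B t :
    (forall u, u \in S -> sat M S V (K A) u -> sat M S V (K B) u) ->
  sat M S V (Kh A) t -> sat M S V (Kh B) t.
Proof. exact: cl_mono. Qed.

Lemma sat_Imp M S V A B t :
  sat M S V (Imp A B) t = (sat M S V A t ==> sat M S V B t).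
Proof. by rewrite /= negb_and negbK implybE. Qed.

Lemma sat_Neg M S V A t : sat M S V (Neg A) t = ~~ sat M S V A t.
Proof. by []. Qed.

Lemma sat_And M S V A B t :
  sat M S V (And A B) t = sat M S V A t && sat M S V B t.
Proof. by []. Qed.

Lemma bool_eval_sat M S V t A :
  bool_eval (fun B => sat M S V B t) A = sat M S V A t.
Proof. by elim: A => //= [A -> | A -> B ->]. Qed.

Lemma sat_subst M S p B A V :
  sat M S V (subst p B A)
  =1 sat M S (fun q => if q == p then sat M S V B else V q) A.
Proof.
elim: A => [q|A IH|A IHA C IHC|A IH|A IH] t /=.
- by case: eqP.
- by rewrite IH.
- by rewrite IHA IHC.
- by apply: eq_all => u; rewrite IH.
- by apply: eq_cl => w; apply: eq_all => u; rewrite IH.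
Qed.

(** Everything follows from [sim] being an equivalence and from the closure laws. Quantifying over
    [V] after the derivation lets the substitution case use the valuation altered at [p]. *)
Lemma sat_SKH M S A : SKH A -> forall V, all (sat M S V A) S.
Proof.
elim=> {A} [A tautA|p q _|p|p|p|p|p|p|p||A B _ IHA _ IHAB|A _ IHA|A B _ IHAB
           |p A B _ IHA] V; apply/allP => t St.
- by rewrite -bool_eval_sat.
- rewrite sat_Imp sat_And; apply/implyP => /andP[/sat_K Kp /sat_K Kpq].
  apply/sat_K => u Su tu; have := Kpq u Su tu.
  by rewrite sat_Imp => /implyP; apply; apply: Kp.
- by rewrite sat_Imp; apply/implyP => /sat_K; apply=> //; apply: sim_refl.
- rewrite sat_Imp; apply/implyP => /sat_K Kp.
  apply/sat_K => u Su tu; apply/sat_K => w Sw uw.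
  by apply: Kp => //; apply: sim_trans uw.
- rewrite sat_Imp sat_Neg; apply/implyP => nKp; apply/sat_K => u Su tu.
  rewrite sat_Neg; apply: contra nKp => /sat_K Kp; apply/sat_K => w Sw tw.
  by apply: Kp => //; rewrite -(simT tu).
- by rewrite sat_Imp; apply/implyP; apply: sub_cl.
- rewrite sat_Imp; apply/implyP; apply: sat_Kh_mono => u _ /sat_K Kp.
  apply/sat_K => w Sw uw; apply/sat_K => x Sx wx.
  by apply: Kp => //; apply: sim_trans wx.
- rewrite sat_Imp; apply/implyP => Hp; apply/sat_K => u _ tu.
  exact: sim_cl Hp.
- rewrite sat_Imp !sat_Kh; apply/implyP => Hp; apply: cl_idem.
  by apply: cl_mono Hp => u Su /sat_K; apply=> //; apply: sim_refl.
(* The conjunct [has X S] of [cl] makes the closure of the empty set empty. *)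
- rewrite sat_Imp sat_Kh; apply/implyP => /clP[[u Su /sat_K Kbot] _].
  by have := Kbot u Su (sim_refl M u); rewrite /= andbN.
- move/allP: (IHAB V) => /(_ t St); rewrite sat_Imp => /implyP; apply.
  by move/allP: (IHA V); apply.
- by apply/sat_K => u Su _; move/allP: (IHA V); apply.
- rewrite sat_Imp; apply/implyP; apply: sat_Kh_mono => u Su /sat_K KA.
  apply/sat_K => w Sw uw; move/allP: (IHAB V) => /(_ w Sw).
  by rewrite sat_Imp => /implyP; apply; apply: KA.
- rewrite sat_subst.
  by move/allP: (IHA (fun q => if q == p then sat M S V B else V q)); apply.
Qed.

(** * The truth lemma *)

Lemma leq_cpair a b : (a <= cpair a b) * (b <= cpair a b).
Proof.
by rewrite /cpair leq_addl; split=> //; rewrite binS bin1; lia.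
Qed.

(** Coherence supplies each induction step, since subformulas of a formula with code below [M] again
    have codes below [M]. *)
Lemma sat_code M S t A : coherent M S -> t \in S -> code A < M ->
  sat M S (fun p u => bit u (5 * p)) A t = bit t (code A).
Proof.
move=> /allP cohS; elim: A t => [p|A IH|A IHA B IHB|A IH|A IH] t St //= ltA.
- have /allP/(_ (code A)) := cohS t St; rewrite mem_iota => /(_ ltac:(lia)).
  by case/and4P=> /implyP/(_ ltA)/eqP-> _ _ _; rewrite IH //; lia.
- have [leA leB] := leq_cpair (code A) (code B).
  have /allP/(_ (code A)) := cohS t St; rewrite mem_iota => /(_ ltac:(lia)).
  case/and4P=> _ /allP/(_ (code B)); rewrite mem_iota => /(_ ltac:(lia)).
  by move=> /implyP/(_ ltA)/eqP-> _ _; rewrite IHA ?IHB //; lia.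
- have /allP/(_ (code A)) := cohS t St; rewrite mem_iota => /(_ ltac:(lia)).
  case/and4P=> _ _ /implyP/(_ ltA)/eqP-> _.
  by apply: eq_in_all => u Su; rewrite IH //; lia.
- have /allP/(_ (code A)) := cohS t St; rewrite mem_iota => /(_ ltac:(lia)).
  case/and4P=> _ _ _ /implyP/(_ ltA)/eqP->.
  (* The code of [K A] is one less than that of [Kh A], hence below [M], so coherence also governs
     the set being closed. *)
  have satK u : u \in S ->
      all (fun w => sim M u w ==> sat M S (fun p u => bit u (5 * p)) A w) S
      = bit u (5 * code A + 3).
    move=> Su; have /allP/(_ (code A)) := cohS u Su.
    rewrite mem_iota => /(_ ltac:(lia)) /and4P[_ _ /implyP/(_ ltac:(lia))/eqP-> _].
    by apply: eq_in_all => w Sw; rewrite IH //; lia.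
  by apply/idP/idP; apply: cl_mono => u Su; rewrite satK.
Qed.

Lemma refutable_not_SKH A : refutable (code A) -> ~ SKH A.
Proof.
case/hasP=> s _ /andP[cohS /hasP[t St nA]] /sat_SKH.
move=> /(_ (code A).+1 (members s (code A).+1) (fun p u => bit u (5 * p))).
by move/allP/(_ t St); rewrite sat_code //; apply/negP.
Qed.

(** * Derivations *)

Ltac taut :=
  let v := fresh "v" in
  move=> v; rewrite /Imp /Bot /=;
  repeat match goal with
  | |- context [bool_eval v ?A] => case: (bool_eval v A)
  | |- context [v ?A] => case: (v A)
  end; done.

Lemma SKH_taut1 A B : SKH A -> tautology (Imp A B) -> SKH B.
Proof. by move=> HA /ax_taut; apply: rule_MP. Qed.

Lemma SKH_taut2 A B C :
  SKH A -> SKH B -> tautology (Imp A (Imp B C)) -> SKH C.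
Proof. by move=> HA HB /(SKH_taut1 HA); apply: rule_MP. Qed.

Lemma SKH_trans A B C : SKH (Imp A B) -> SKH (Imp B C) -> SKH (Imp A C).
Proof. by move=> HAB HBC; apply: SKH_taut2 HAB HBC _; taut. Qed.

(** A variable [p] in [A] satisfies [5 * p <= code A], so any index above [code A] is fresh. *)
Lemma subst_fresh q A B : code A < q -> subst q B A = A.
Proof.
elim: A => [p|A IH|A IHA C IHC|A IH|A IH] /= lt_q; rewrite ?IH //; try lia.
  by case: eqP => // E; lia.
have [leA leC] := leq_cpair (code A) (code C).
by rewrite IHA ?IHC //; lia.
Qed.

Lemma SKH_T A : SKH (Imp (K A) A).
Proof. exact: (rule_Sub 0 A (ax_T 0)). Qed.

Lemma SKH_4 A : SKH (Imp (K A) (K (K A))).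
Proof. exact: (rule_Sub 0 A (ax_4 0)). Qed.

Lemma SKH_5 A : SKH (Imp (Neg (K A)) (K (Neg (K A)))).
Proof. exact: (rule_Sub 0 A (ax_5 0)). Qed.

Lemma SKH_KtoKh A : SKH (Imp (K A) (Kh A)).
Proof. exact: (rule_Sub 0 A (ax_KtoKh 0)). Qed.

Lemma SKH_KhtoKhK A : SKH (Imp (Kh A) (Kh (K A))).
Proof. exact: (rule_Sub 0 A (ax_KhtoKhK 0)). Qed.

Lemma SKH_KhtoKKh A : SKH (Imp (Kh A) (K (Kh A))).
Proof. exact: (rule_Sub 0 A (ax_KhtoKKh 0)). Qed.

Lemma SKH_KhKh A : SKH (Imp (Kh (Kh A)) (Kh A)).
Proof. exact: (rule_Sub 0 A (ax_KhKh 0)). Qed.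

(* The second variable is chosen fresh for [A], so that the two successive
   substitutions amount to a simultaneous one. *)
Lemma SKH_distK A B : SKH (Imp (And (K A) (K (Imp A B))) (K B)).
Proof.
pose q := (code A).+1; have neq_q : q.+1 <> q by lia.
have := rule_Sub q B (rule_Sub q.+1 A (ax_distK neq_q)).
rewrite /= eqxx; have -> : (q == q.+1) = false by lia.
by rewrite /= eqxx subst_fresh.
Qed.

Lemma SKH_monoK A B : SKH (Imp A B) -> SKH (Imp (K A) (K B)).
Proof. by move/rule_NecK => HAB; apply: SKH_taut2 HAB (SKH_distK A B) _; taut. Qed.

Lemma SKH_K_And A B : SKH (Imp (And (K A) (K B)) (K (And A B))).
Proof.
have /SKH_monoK HA : SKH (Imp A (Imp B (And A B))) by apply: ax_taut; taut.
by apply: SKH_taut2 HA (SKH_distK B (And A B)) _; taut.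
Qed.

(** By T, [Neg (Kh A)] yields [Neg (K (Kh A))], which is known by axiom 5; contraposing
    [SKH_KhtoKKh] under [K] finishes. *)
Lemma SKH_nKh A : SKH (Imp (Neg (Kh A)) (K (Neg (Kh A)))).
Proof.
have H1 : SKH (Imp (Neg (Kh A)) (Neg (K (Kh A)))).
  by apply: SKH_taut1 (SKH_T (Kh A)) _; taut.
apply: SKH_trans H1 (SKH_trans (SKH_5 (Kh A)) (SKH_monoK _)).
by apply: SKH_taut1 (SKH_KhtoKKh A) _; taut.
Qed.

(** * Consistent types *)

Lemma cpair_surj n : {xy | cpair xy.1 xy.2 = n}.
Proof.
(* The pairs are enumerated along diagonals: [(x.+1, y)] is followed by [(x, y.+1)], and [(0, y)] by
   [(y.+1, 0)]. *)
elim: n => [|n [[[|x] y] /= Exy]]; first by exists (0, 0).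
  by exists (y.+1, 0); rewrite -Exy /= /cpair !addn0 add0n (binS y.+1) bin1; lia.
by exists (x, y.+1); rewrite -Exy /= /cpair (addnS x) addSn; lia.
Qed.

(** The remainder modulo 5 selects the constructor and the quotient encodes its arguments. The
    informative existential makes [decode] a function. *)
Lemma code_surj n : {A | code A = n}.
Proof.
elim/ltn_ind: n => n IHn.
have En : n = 5 * (n %/ 5) + n %% 5 by lia.
have lt_n : 0 < n %% 5 -> n %/ 5 < n by lia.
move: (n %/ 5) (n %% 5) (ltn_pmod n (isT : 0 < 5)) En lt_n => m r.
case: r => [|[|[|[|[|//]]]]] _ En => [_|lt_m|lt_m|lt_m|lt_m].
- by exists (Var m); rewrite /=; lia.
- by have [A EA] := IHn m (lt_m isT); exists (Neg A); rewrite /=; lia.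
- have [[x y] /= Exy] := cpair_surj m; have [lex ley] := leq_cpair x y.
  have [A EA] := IHn x ltac:(lia); have [B EB] := IHn y ltac:(lia).
  by exists (And A B); rewrite /= EA EB; lia.
- by have [A EA] := IHn m (lt_m isT); exists (K A); rewrite /=; lia.
- by have [A EA] := IHn m (lt_m isT); exists (Kh A); rewrite /=; lia.
Qed.

Definition decode (n : nat) : formula := sval (code_surj n).

Lemma decodeK : cancel decode code.
Proof. by move=> n; rewrite /decode; case: code_surj. Qed.

Lemma codeK : cancel code decode.
Proof. by move=> A; apply: code_inj; rewrite decodeK. Qed.

Definition lit (b : bool) (A : formula) : formula := if b then A else Neg A.

(** The filter [d] is [predT] for full descriptions of types and [modal] for descriptions of
    [sim]-classes. [Neg Bot] serves as truth. *)
Fixpoint conj_lits (p : nat -> bool) (d : pred formula) (M : nat) : formula :=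
  if M is n.+1 then
    And (conj_lits p d n)
        (if d (decode n) then lit (p n) (decode n) else Neg Bot)
  else Neg Bot.

Lemma bool_eval_conj_lits v p (d : pred formula) M :
  reflect (forall A, d A -> code A < M -> bool_eval v A = p (code A))
          (bool_eval v (conj_lits p d M)).
Proof.
apply: (iffP idP).
  elim: M => // n IHn /= /andP[/IHn H Hn] A dA; rewrite ltnS leq_eqVlt.
  case/orP=> [/eqP EA|]; last exact: H.
  by move: Hn; rewrite -EA codeK dA /lit; case: (p _) => /= [->|/negbTE->].
elim: M => [_|n IHn H] /=; first by rewrite andbN.
rewrite IHn => [|A dA lt_A]; last by apply: H => //; apply: ltnW.
case dn: (d _) => /=; last by rewrite andbN.
by have := H _ dn; rewrite decodeK /lit => /(_ (ltnSn n)); case: (p n) => /= ->.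
Qed.

Definition consistent (A : formula) : Prop := ~ SKH (Neg A).

(** If no valuation satisfied both formulas, [Imp F (Neg A)] would be a tautology. Theorems can thus
    be applied to types by evaluation. *)
Lemma consistent_eval A F :
  consistent A -> SKH F -> exists2 v, bool_eval v A & bool_eval v F.
Proof.
move=> consA HF; apply: NNPP => nv; apply: consA; apply: SKH_taut1 HF _ => v /=.
by rewrite negbK; apply/negP => /andP[vF vA]; apply: nv; exists v.
Qed.

Lemma consistent_split A B :
  consistent A -> exists b, consistent (And A (lit b B)).
Proof.
move=> consA; have [cB|nB] := classic (consistent (And A B)); first by exists true.
exists false => nnB; apply: consA; apply: SKH_taut2 (NNPP _ nB) nnB _; taut.
Qed.

Definition consistent_type (M t : nat) : Prop :=
  consistent (conj_lits (bit t) predT M).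

(** A finite Lindenbaum construction: literals are added in the order of codes, each with a sign
    that preserves consistency, and the signs are then packed into a number. *)
Lemma consistent_extend M A : consistent A ->
  exists2 t, t < 2 ^ M & consistent (And A (conj_lits (bit t) predT M)).
Proof.
move=> consA.
have [p Hp] : exists p, consistent (And A (conj_lits p predT M)).
  elim: M => [|n [p Hp]].
    by exists xpredT => nA; apply: consA; apply: SKH_taut1 nA _; taut.
  have [b Hb] := consistent_split (decode n) Hp.
  pose q i := if i == n then b else p i; exists q => nH; apply: Hb.
  apply: SKH_taut1 nH _ => v.
  set L := conj_lits _ _ n.+1; rewrite /= !negbK; apply/negP => /andP[nAL].
  case/andP=> /andP[vA /bool_eval_conj_lits vL] vb.
  move: nAL; rewrite vA /=; case/negP.
  apply/(bool_eval_conj_lits v q predT n.+1) => B _.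
  rewrite ltnS leq_eqVlt /q.
  case: eqP => [EB _|_] /=; last exact: vL.
  by move: vb; rewrite -EB codeK; case: (b) => /= [->|/negbTE->].
have [t lt_t Ht] := exists_bits p M.
exists t => // nH; apply: Hp; apply: SKH_taut1 nH _ => v.
set L := conj_lits (bit t) _ _; rewrite /= !negbK; apply/negP => /andP[nAL].
case/andP=> vA /bool_eval_conj_lits vL; move: nAL; rewrite vA /=; case/negP.
rewrite {}/L; apply/bool_eval_conj_lits => B _ ltB; rewrite vL //.
by apply/idP/idP => /(Ht _ ltB).
Qed.

Lemma bool_eval_Imp v A B :
  bool_eval v (Imp A B) = (bool_eval v A ==> bool_eval v B).
Proof. by rewrite /= negb_and negbK implybE. Qed.

Definition agrees (M : nat) (v : formula -> bool) (t : nat) : Prop :=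
  forall A, code A < M -> bool_eval v A = bit t (code A).

Lemma consistent_type_eval M t F : consistent_type M t -> SKH F ->
  exists2 v, bool_eval v F & agrees M v t.
Proof.
move=> const HF; have [v /bool_eval_conj_lits vt vF] := consistent_eval const HF.
by exists v => // A; apply: vt.
Qed.

Lemma consistent_realized M A : consistent A ->
  exists t, [/\ t < 2 ^ M, consistent_type M t
              & exists2 v, bool_eval v A & agrees M v t].
Proof.
move=> consA; have [t lt_t Ht] := consistent_extend M consA.
exists t; split=> //.
  by move=> nt; apply: Ht; apply: SKH_taut1 nt _; taut.
have [v /andP[vA /bool_eval_conj_lits vt] _] :
    exists2 v, bool_eval v (And A (conj_lits (bit t) predT M)) & bool_eval v (Neg Bot).
  by apply: consistent_eval Ht _; apply: ax_taut; taut.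
by exists v => // B; apply: vt.
Qed.

Definition modal (A : formula) : bool :=
  match A with K _ | Kh _ => true | _ => false end.

(** Each modal literal implies its own knowledge: by [SKH_4] and [SKH_5] for [K], by [SKH_KhtoKKh]
    and [SKH_nKh] for [Kh]. *)
Lemma SKH_K_conj_modal p M :
  SKH (Imp (conj_lits p modal M) (K (conj_lits p modal M))).
Proof.
have Ktop : SKH (K (Neg Bot)) by apply/rule_NecK/ax_taut; taut.
elim: M => [|n IHn] /=; first by apply: SKH_taut1 Ktop _; taut.
set L := conj_lits _ _ _ in IHn *; set X := (X in And L X).
have KX : SKH (Imp X (K X)).
  rewrite /X; case: (decode n) => [q|A|A B|A|A] /=;
    try by apply: SKH_taut1 Ktop _; taut.
    by rewrite /lit; case: (p n); [apply: SKH_4 | apply: SKH_5].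
  by rewrite /lit; case: (p n); [apply: SKH_KhtoKKh | apply: SKH_nKh].
have KLX : SKH (Imp (And L X) (And (K L) (K X))).
  by apply: SKH_taut2 IHn KX _; taut.
exact: SKH_trans KLX (SKH_K_And L X).
Qed.

Lemma simE M t u : sim M t u <->
  (forall A, modal A -> code A < M -> bit t (code A) = bit u (code A)).
Proof.
split=> [/simP tu [q|A|A B|A|A] //= _ lt_A | H].
- by have [] := tu (code A); auto.
- by have [] := tu (code A); auto.
apply/simP => c; have := H (K (decode c)); have := H (Kh (decode c)).
by rewrite /= decodeK => H4 H3; split; [apply: H3 | apply: H4].
Qed.

(** The Boolean clauses follow by evaluation; the two modal clauses realize suitable consistent
    formulas by types of [S]. *)
Lemma coherent_consistent M S :
    (forall t, t \in S <-> t < 2 ^ M /\ consistent_type M t) -> coherent M S.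
Proof.
move=> HS; apply/allP => t St; have [_ const] := (HS t).1 St.
have evalS u F : u \in S -> SKH F -> exists2 v, bool_eval v F & agrees M v u.
  by move=> /HS[_ consu]; apply: consistent_type_eval.
have realS A : consistent A ->
    exists2 u, u \in S & exists2 v, bool_eval v A & agrees M v u.
  by case/(consistent_realized M) => u [lt_u consu Hv]; exists u => //; apply/HS.
apply/allP => c _; rewrite -(decodeK c); move: (decode c) => {c} A.
have Htop : SKH (Neg Bot) by apply: ax_taut; taut.
have [v _ vt] := evalS t _ St Htop.
have leT u B : u \in S -> 5 * code B + 3 < M ->
    bit u (5 * code B + 3) -> bit u (code B).
  move=> Su lt_B Ku; have [w + wu] := evalS u _ Su (SKH_T B).
  by rewrite bool_eval_Imp (wu (K B)) // (wu B) /= ?Ku //; lia.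
apply/and4P; split.
- apply/implyP => lt_A; rewrite -(vt (Neg A)) // -(vt A) //; lia.
- apply/allP => d _; apply/implyP; rewrite -(decodeK d) => lt_A.
  have [leA leB] := leq_cpair (code A) (code (decode d)).
  by rewrite -(vt (And A (decode d))) // -(vt A) -?(vt (decode d)) //; lia.
- apply/implyP => lt_A; apply/eqP; apply/idP/allP => [KA u Su | HA].
    by apply/implyP => /simP/(_ (code A))[/(_ lt_A) E _]; apply: leT; rewrite -?E.
  apply: contraT => nKA.
  (* If the modal part of [t] implied [A], it would imply [K A] by introspection, and [t] would
     contain [K A]. Hence some type similar to [t] refutes [A]. *)
  have consX : consistent (And (Neg A) (conj_lits (bit t) modal M)).
    move=> nX; have XA : SKH (Imp (conj_lits (bit t) modal M) A).
      by apply: SKH_taut1 nX _; taut.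
    have [w + wt] :=
      evalS t _ St (SKH_trans (SKH_K_conj_modal _ _) (SKH_monoK XA)).
    rewrite bool_eval_Imp (wt (K A)) // => /implyP wKA; case/negP: nKA.
    by apply: wKA; apply/bool_eval_conj_lits => B _; apply: wt.
  have [u Su [w /= /andP[nwA /bool_eval_conj_lits wX] wu]] := realS _ consX.
  have tu : sim M t u by apply/simE => B mB lt_B; rewrite -wX // wu.
  by move: nwA; rewrite wu ?(implyP (HA u Su) tu) //; lia.
- apply/implyP => lt_A; have lt_A3 : 5 * code A + 3 < M by lia.
  apply/eqP; apply/idP/clP => [KhA | [_ /(_ (code A) lt_A)]].
    (* As [Kh A] implies [Kh (K A)], a derivation of [Imp (Kh (K A)) (Kh B)] would force [Kh B] into
       [t]. *)
    have refuteK B : (forall w, agrees M w t -> ~~ bool_eval w (Kh B)) ->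
        SKH (Imp (Kh (K A)) (Kh B)) -> False.
      move=> nB /(SKH_trans (SKH_KhtoKhK A)) /(evalS t _ St)[w + wt].
      by rewrite bool_eval_Imp (wt (Kh A)) //= KhA; apply/negP/(nB w wt).
    split.
      (* Otherwise [Kh A] would imply [Kh (K A)], hence [Kh Bot], hence [Bot]. *)
      have consK : consistent (K A).
        move=> nK; have /rule_MonoKh HB : SKH (Imp (K A) Bot).
          by apply: SKH_taut1 nK _; taut.
        have KhnA : SKH (Neg (Kh A)).
          apply: SKH_taut1 (SKH_trans (SKH_KhtoKhK A) (SKH_trans HB ax_Khbot)) _.
          by taut.
        have [w nKhA wt] := evalS t _ St KhnA.
        by move: nKhA; rewrite /= [w _](wt (Kh A)) //= KhA.
      have [u Su [w wA wu]] := realS _ consK.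
      by exists u => //; rewrite -(wu (K A)).
    move=> e lt_e HY; apply: contraT => nE; rewrite -(decodeK e) in lt_e HY nE.
    move: (decode e) lt_e HY nE => {e} B lt_B HY nB.
    (* Otherwise [Kh (K A)] would imply [Kh (Kh B)] and so [Kh B]. A type realizing this formula is
       in the set being closed but lacks [Kh B], against [HY]. *)
    have consKB : consistent (And (K A) (Neg (Kh B))).
      move=> nKB; have /rule_MonoKh HB : SKH (Imp (K A) (Kh B)).
        by apply: SKH_taut1 nKB _; taut.
      apply: (refuteK B _ (SKH_trans HB (SKH_KhKh B))) => w wt.
      by rewrite (wt (Kh B)).
    have [u Su [w /andP[wA nwB] wu]] := realS _ consKB.
    by move: nwB; rewrite /= [w _](wu (Kh B)) //= HY // -(wu (K A)).
  (* Conversely, the extension of [Kh A] is itself one of the intersected sets, and it contains that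
     of [K A] by [SKH_KtoKh]. *)
  apply=> u Su KA; have [w + wu] := evalS u _ Su (SKH_KtoKh A).
  by rewrite bool_eval_Imp (wu (K A)) // (wu (Kh A)) //= KA.
Qed.

(** * Completeness of the criterion and decidability *)

Lemma not_SKH_refutable A : ~ SKH A -> refutable (code A).
Proof.
move=> nA; set M := (code A).+1.
(* One digit for each of the [2 ^ M] candidate types puts the model within the search bound of
   [refutable]. *)
have [s lt_s Hs] := exists_bits (consistent_type M) (2 ^ M).
have HS t : t \in members s M <-> t < 2 ^ M /\ consistent_type M t.
  rewrite mem_members; split=> [/andP[lt_t /(Hs t lt_t)] // | [lt_t const]].
  by rewrite lt_t; apply/(Hs t lt_t).
apply/hasP; exists s; first by rewrite mem_iota.
rewrite coherent_consistent //=; apply/hasP.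
have consA : consistent (Neg A).
  by move=> nnA; apply: nA; apply: SKH_taut1 nnA _; taut.
have [t [lt_t const [v /= vA vt]]] := consistent_realized M consA.
by exists t; [apply/HS | rewrite -vt].
Qed.

Theorem theorem4p10 : decided_by_algorithm SKH.
Proof.
(* Derivability is the complement of refutability, so the algorithm negates the answer of the
   search. *)
have [f Hf] := computable_neg computable_refutable.
exists f => A; have := Hf [tuple code A]; rewrite /= => HfA.
split=> HA; move: HfA.
  by case: (boolP (refutable _)) => // /refutable_not_SKH.
by rewrite not_SKH_refutable.
Qed.
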